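(* Let $(S,\cdot,\ast)$ be a regular $\star$-semigroup. Define binary operations $+$ and $\oplus$ on $S$ by $a+b=a^{\ast}b^{\ast}$ and $a\oplus b=b^{\ast}a^{\ast}$ for all $a,b\in S$. Let $\boxplus$ denote either one of $+$, $\oplus$. Then (for each of the two choices of $\boxplus$) the following statements are equivalent: (1) $(S,\boxplus)$ is a semigroup (i.e. $\boxplus$ is associative). (2) $x(y\boxplus z)=xy\boxplus x(x^{\ast}\boxplus z)$ for all $x,y,z\in S$. (3) $(z\boxplus y)x=(z\boxplus x^{\ast})x\boxplus yx$ for all $x,y,z\in S$. (4) $x=x^{\ast}$ for all $x\in S$. Thus $(S,\boxplus,\cdot,\ast)$ is a left (or equivalently, right; or equivalently, two-sided) regular $\star$-semibrace if and only if $x=x^{\ast}$ for all $x\in S$.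
   Context: A regular $\star$-semigroup is a triple $(S,\cdot,\ast)$ where $(S,\cdot)$ is a semigroup on a non-empty set and $\ast:S\to S$, $x\mapsto x^\ast$, satisfies $xx^\ast x=x$, $(x^\ast)^\ast=x$, $(xy)^\ast=y^\ast x^\ast$ for all $x,y\in S$. Let $(S,\boxplus,\cdot,\ast)$ be such that $(S,\boxplus)$ is a semigroup and $(S,\cdot,\ast)$ is a regular $\star$-semigroup. It is a left regular $\star$-semibrace if $x(y\boxplus z)=xy\boxplus x(x^{\ast}\boxplus z)$ for all $x,y,z\in S$; a right regular $\star$-semibrace if $(z\boxplus y)x=(z\boxplus x^{\ast})x\boxplus yx$ for all $x,y,z\in S$; two-sided if both hold. Multiplication has precedence over $+$, $\oplus$, $\boxplus$. *)

(* Defs.v *)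
From mathcomp Require Import ssreflect ssrfun ssrbool ssrnat seq.

Set Implicit Arguments.
Unset Strict Implicit.
Unset Printing Implicit Defensive.

(* One carrier bears several multiplications, so the operations are explicit
   arguments rather than canonical structures; [S] is an arbitrary nonempty
   type, without the choiceType requirement of semigroupType. *)
Record regular_star_semigroup (S : Type) (mul : S -> S -> S) (star : S -> S)
    : Prop := RegularStarSemigroup {
  rss_nonempty : inhabited S;
  rss_mulA : associative mul;
  rss_regular : forall x, mul (mul x (star x)) x = x;
  rss_starK : involutive star;
  rss_starM : forall x y, star (mul x y) = mul (star y) (star x)
}.

Section Semibraces.
Variables (S : Type) (boxplus mul : S -> S -> S) (star : S -> S).

Definition left_semibrace_law : Prop :=
  forall x y z : S,
    mul x (boxplus y z) = boxplus (mul x y) (mul x (boxplus (star x) z)).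

Definition right_semibrace_law : Prop :=
  forall x y z : S,
    mul (boxplus z y) x = boxplus (mul (boxplus z (star x)) x) (mul y x).

Record left_regular_star_semibrace : Prop := LeftRegularStarSemibrace {
  lrss_boxplusA : associative boxplus;
  lrss_star_semigroup : regular_star_semigroup mul star;
  lrss_law : left_semibrace_law
}.

Record right_regular_star_semibrace : Prop := RightRegularStarSemibrace {
  rrss_boxplusA : associative boxplus;
  rrss_star_semigroup : regular_star_semigroup mul star;
  rrss_law : right_semibrace_law
}.

Definition two_sided_regular_star_semibrace : Prop :=
  left_regular_star_semibrace /\ right_regular_star_semibrace.

End Semibraces.

Section DerivedSums.
Variables (S : Type) (mul : S -> S -> S) (star : S -> S).

Definition star_plus (a b : S) : S := mul (star a) (star b).

Definition star_oplus (a b : S) : S := mul (star b) (star a).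

End DerivedSums.

(* Main.v *)
Require Import Defs.
From mathcomp Require Import ssreflect ssrfun ssrbool ssrnat seq.

(** Each of the identities (1)-(3), evaluated at projections [p = p^* = p p],
    yields [p z = p z^* p] for all [z].  Applying the involution, projections
    are then central, and [p = x x^*] gives [x = p x = p x^* p = x^*].
    Conversely, if the involution is trivial then [S] is commutative with
    [x x x = x] and [boxplus] is the multiplication. *)

Set Implicit Arguments.
Unset Strict Implicit.

Section StarIdentity.
Variables (S : Type) (mul : S -> S -> S) (star : S -> S).
Hypothesis hS : regular_star_semigroup mul star.

Local Notation "x ** y" := (mul x y) (at level 40, left associativity).
Local Notation "x ^*" := (star x).

Let mulA : associative mul := rss_mulA hS.
Let starK : involutive star := rss_starK hS.
Let starM : forall x y, (x ** y)^* = y^* ** x^* := rss_starM hS.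
Let regular : forall x, x ** x^* ** x = x := rss_regular hS.

Let starE := (starM, starK, mulA).

Lemma star_id_of_projections :
    (forall p z, p^* = p -> p ** p = p -> p ** z = p ** z^* ** p) ->
  forall x, x = x^*.
Proof.
move=> H x.
(* Starring [H] at [star z] gives [z ** p = p ** star z ** p], which [H] at [z] equates with
   [p ** z]. *)
have central p z : p^* = p -> p ** p = p -> p ** z = z ** p.
  move=> sp pp; have := congr1 star (H p z^* sp pp).
  by rewrite !starE sp -(H p z) // => ->.
set p := x ** x^*.
have sp : p^* = p by rewrite /p !starE.
have pp : p ** p = p by rewrite /p mulA regular.
have px : p ** x = x by exact: regular.
have xp : x^* ** p = x^* by rewrite -{1}sp -starM px.
by rewrite -{1}px H // -mulA xp central.
Qed.

Section Identities.
Variable boxplus : S -> S -> S.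
Hypothesis hbox : boxplus = star_plus mul star \/ boxplus = star_oplus mul star.

Lemma star_id_of_boxplusA : associative boxplus -> forall x, x = x^*.
Proof.
move=> A; apply: star_id_of_projections => p z sp pp.
case: hbox A => -> A.
  (* The two bracketings evaluate to [p ** star z ** p] and [p ** z]. *)
  have := A p p z^*.
  by rewrite /star_plus !starE sp pp.
(* For [star_oplus] they are [p ** z ** p] and [star z ** p]; starring moves [p] to the left. *)
have := congr1 star (A p p z).
by rewrite /star_oplus !starE sp pp.
Qed.

Lemma star_id_of_left_law :
  left_semibrace_law boxplus mul star -> forall x, x = x^*.
Proof.
move=> L; apply: star_id_of_projections => p z sp pp.
case: hbox L => -> L.
  have := L p p z^*.
  by rewrite /star_plus !starE sp pp -!mulA pp.
(* For [star_oplus], the instance at [p], [p], [star z] only gives [p ** z ** p = p ** star z ** p];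
   this absorption rule removes the last [p] on the left. *)
have pyp y : p ** y = p ** y ** p.
  have := L p y^* p.
  by rewrite /star_oplus !starE sp !pp.
have := L p p z^*.
by rewrite /star_oplus !starE sp -pyp => ->; rewrite -!mulA !pp.
Qed.

Lemma star_id_of_right_law :
  right_semibrace_law boxplus mul star -> forall x, x = x^*.
Proof.
move=> R; apply: star_id_of_projections => p z sp pp.
case: hbox R => -> R.
  (* The law itself reads [star z ** p = p ** z ** p], so it is starred. *)
  have := congr1 star (R p p z).
  by rewrite /star_plus !starE sp pp -!mulA pp.
have pyp y : p ** y = p ** y ** p.
  have := congr1 star (R p y p).
  by rewrite /star_oplus !starE sp !pp.
have := R p p z^*.
by rewrite /star_oplus !starE sp !pp -pyp.
Qed.

Section TrivialStar.
Hypothesis star_id : forall x, x = x^*.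

(** A trivial involution that reverses products forces commutativity. *)
Let mulC : commutative mul.
Proof. by move=> x y; rewrite [LHS]star_id starM -!star_id. Qed.

Let boxplusE x y : boxplus x y = x ** y.
Proof.
by case: hbox => ->; rewrite /star_plus /star_oplus -!star_id // mulC.
Qed.

Let mulxxx x : x ** x ** x = x.
Proof. by rewrite {2}[x]star_id regular. Qed.

Lemma boxplusA_of_star_id : associative boxplus.
Proof. by move=> x y z; rewrite !boxplusE mulA. Qed.

(** Up to commutativity the right side is [y ** x ** x ** x ** z], and the cube of [x] collapses to
    [x]. *)
Lemma left_law_of_star_id : left_semibrace_law boxplus mul star.
Proof.
move=> x y z; rewrite !boxplusE -star_id !mulA (mulC x y).
by rewrite -(mulA y x x) -(mulA y _ x) mulxxx.
Qed.

Lemma right_law_of_star_id : right_semibrace_law boxplus mul star.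
Proof.
move=> x y z; rewrite !boxplusE -star_id -!mulA (mulC y x) !mulA.
by rewrite -(mulA z x x) -(mulA z _ x) mulxxx.
Qed.

End TrivialStar.
End Identities.
End StarIdentity.

Theorem proposition3p4 (S : Type) (mul : S -> S -> S) (star : S -> S)
    (hS : regular_star_semigroup mul star)
    (boxplus : S -> S -> S)
    (hbox : boxplus = star_plus mul star \/ boxplus = star_oplus mul star) :
  [<-> associative boxplus;
       left_semibrace_law boxplus mul star;
       right_semibrace_law boxplus mul star;
       forall x : S, x = star x]
  /\ (left_regular_star_semibrace boxplus mul star
        <-> (forall x : S, x = star x))
  /\ (right_regular_star_semibrace boxplus mul star
        <-> (forall x : S, x = star x))
  /\ (two_sided_regular_star_semibrace boxplus mul star
        <-> (forall x : S, x = star x)).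
Proof.
have toA := star_id_of_boxplusA hS hbox.
have ofA := boxplusA_of_star_id hS hbox.
have ofL := left_law_of_star_id hS hbox.
have ofR := right_law_of_star_id hS hbox.
have eL : left_regular_star_semibrace boxplus mul star <->
    (forall x, x = star x).
  by split=> [[/toA] //|id]; split; [exact: ofA | | exact: ofL].
have eR : right_regular_star_semibrace boxplus mul star <->
    (forall x, x = star x).
  by split=> [[/toA] //|id]; split; [exact: ofA | | exact: ofR].
split; last by split=> //; split=> //; split=> [[/eL]|id] //; split;
  [apply/eL | apply/eR].
(* In the cycle of implications, those between two of the identities pass through triviality of
   [star]. *)
tfae=> //.
- by move/toA/ofL.
- by move/(star_id_of_left_law hS hbox)/ofR.
- exact (star_id_of_right_law hS hbox).
Qed.
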